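(* Let $Z$ be a metrizable space, and let $(X,d)$ be a metric space such that there exists a metric space $(Y,D)$ containing $X$ as a subspace with $D|_{X^2}=d$, and there exists a closed topological embedding from $Y\oplus\{pt\}$ to $Z$. Then there exists an isometric embedding $J\colon (X,d)\to(\mathrm{Met}(Z),\mathcal{D}_Z)$. Moreover, if $d$ is bounded, then $J$ can be chosen so that $J$ is a map from $(X,d)$ into $\mathrm{BMet}(Z)$.
   Context: For a metrizable space $Z$, $\mathrm{Met}(Z)$ is the set of all metrics on $Z$ that generate the given topology of $Z$, and $\mathrm{BMet}(Z)$ is the set of all bounded metrics in $\mathrm{Met}(Z)$. The sup-metric is $\mathcal{D}_Z(d,e)=\sup_{x,y\in Z}|d(x,y)-e(x,y)|$ (a priori possibly taking the value $\infty$); subsets carry its restriction. An isometric embedding is a distance-preserving map (not necessarily surjective). $\{pt\}$ is the one-point space and $\oplus$ denotes the topological sum (disjoint union topology). A closed topological embedding is a homeomorphism onto a closed subset. *)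

(* Defs.v *)
From HB Require Import structures.
From mathcomp Require Import all_boot all_order all_algebra.
From mathcomp Require Import all_classical all_reals.
From mathcomp Require Import topology ereal.

Set Implicit Arguments.
Unset Strict Implicit.
Unset Printing Implicit Defensive.

Import Order.TTheory GRing.Theory Num.Theory.
Local Open Scope classical_set_scope.
Local Open Scope ring_scope.

(* Nonnegativity of d follows from these axioms, which are those of the
   factory isMetric. *)
Record is_metric {R : realType} {T : Type} (d : T -> T -> R) : Prop := IsMetric {
  dist_refl : forall x, d x x = 0;
  dist_separated : forall x y, d x y = 0 -> x = y;
  dist_symmetric : forall x y, d x y = d y x;
  dist_triangular : forall x y z, d x z <= d x y + d y z
}.

Definition generates_topology {R : realType} {Z : topologicalType}
    (d : Z -> Z -> R) : Prop :=
  forall U : set Z, open U <->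
    (forall x, U x -> exists2 e : R, 0 < e & [set y | d x y < e] `<=` U).

Definition bounded_dist {R : realType} {T : Type} (d : T -> T -> R) : Prop :=
  exists M : R, forall x y, d x y <= M.

Definition Met (R : realType) (Z : topologicalType) : set (Z -> Z -> R) :=
  [set d | is_metric d /\ generates_topology d].
Arguments Met : clear implicits.

Definition BMet (R : realType) (Z : topologicalType) : set (Z -> Z -> R) :=
  Met R Z `&` [set d | bounded_dist d].
Arguments BMet : clear implicits.

Definition metrizable (R : realType) (Z : topologicalType) : Prop :=
  Met R Z !=set0.

(* For empty Z this is the library's supremum of the empty set, -oo. *)
Definition sup_metric {R : realType} {Z : Type} (d e : Z -> Z -> R) : \bar R :=
  ereal_sup [set `|d p.1 p.2 - e p.1 p.2|%:E | p in [set: Z * Z]].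

Definition isometric_embedding_in {R : realType} {X : metricType R} {Z : Type}
    (S : set (Z -> Z -> R)) (J : X -> Z -> Z -> R) : Prop :=
  (forall x, S (J x)) /\
  (forall x y, sup_metric (J x) (J y) = (mdist x y)%:E).

Definition isometric_embedding {R : realType} {X Y : metricType R}
    (i : X -> Y) : Prop :=
  forall x y, mdist (i x) (i y) = mdist x y.

Definition summand (A B : topologicalType) (b : bool) : topologicalType :=
  if b then B else A.

Definition topological_sum (A B : topologicalType) : topologicalType :=
  {b : bool & summand A B b}.

Definition one_point : topologicalType := discrete_topology unit.

(* The last clause says that f is open onto its image, i.e. that the inverse
   range f -> A is continuous for the subspace topology. *)
Definition closed_topological_embedding {A B : topologicalType}
    (f : A -> B) : Prop :=
  [/\ injective f, continuous f, closed (range f) &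
      forall U : set A, open U -> open (f @` U : set (subspace (range f)))].

(* Main.v *)
Require Import Defs.
From mathcomp Require Import all_boot all_order all_algebra.
From mathcomp Require Import all_classical all_reals.
From mathcomp Require Import topology ereal.
From mathcomp Require Import ring lra.

(** Write D for the metric of Y, let p be the image of the isolated point and
    fix x0 in X.  On Y with p adjoined, for x in X, set e_x = D on Y and
    e_x(y, p) = D(x, y) + 1: then e_x and e_x' differ by at most D(x, x'), a
    difference attained at the pair (x', p).  To extend these metrics to
    Z consistently, use Kuratowski coordinates: the functions
    y |-> D(y, a) - D(x0, a), for a in X, extend from the closed set Y to an
    equicontinuous, pointwise bounded family h_a on Z by Hausdorff's formula
    inf_y (v(y) + penalty(z, y)).  With a bump function phi equal to 1 at p and
    0 on Y, put H_(x,a) = (1 - phi) h_a + phi (d(x, a) - d(x0, a) + 1).  The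
    metric assigned to x is
    max (min(rho, 1), sup_a |H_(x,a)(z) - H_(x,a)(z')|) for any rho in Met(Z):
    since H_(x,a) - H_(x',a) = phi (d(x, a) - d(x', a)), the assignment does not
    increase distances, while the pair (x', p) has distance at least
    d(x, x') + 1 for x and exactly 1 for x'.  If d is at most M, truncating
    these metrics at M + 1 makes them bounded and keeps both facts. *)

Set Implicit Arguments.
Unset Strict Implicit.
Unset Printing Implicit Defensive.

Import Order.TTheory GRing.Theory Num.Theory.
Local Open Scope classical_set_scope.
Local Open Scope ring_scope.

Definition equicontinuous_wrt {R : realType} {I T : Type} (d : T -> T -> R)
    (h : I -> T -> R) : Prop :=
  forall z e, 0 < e -> exists2 s, 0 < s &
    forall z', d z z' < s -> forall i, `|h i z - h i z'| <= e.

Lemma dist_ge0 {R : realType} {T : Type} (d : T -> T -> R) :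
  is_metric d -> forall x y, 0 <= d x y.
Proof.
move=> dM x y; have := dist_triangular dM x y x.
by rewrite (dist_refl dM) (dist_symmetric dM y x); lra.
Qed.

(** * Hausdorff's extension of functions from a closed set *)

Section HausdorffExtension.
Context {R : realType} {Z Y : Type} (rho : Z -> Z -> R) (g : Y -> Z).

Definition dist_to z := inf (range (fun y => rho z (g y))).

(* On the range of [g] both the distance and the penalty are 0 (as x / 0 = 0),
   so that the extension below returns the value of [v] there. *)
Definition penalty z y := Num.max 0 (rho z (g y) / dist_to z - 2).

Definition hausdorff_extension (v : Y -> R) z :=
  inf [set v y + penalty z y | y in [set y | range g z -> g y = z]].

Context (rhoM : is_metric rho) (g_inj : injective g).
Context (g_closed :
  forall z, ~ range g z -> exists2 r, 0 < r & forall y, r <= rho z (g y)).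
Context (y0 : Y).

Lemma dist_to_le z y : dist_to z <= rho z (g y).
Proof.
apply: ge_inf; last by exists y.
by exists 0 => _ [y' _ <-]; exact: dist_ge0.
Qed.

Lemma le_dist_to z r : (forall y, r <= rho z (g y)) -> r <= dist_to z.
Proof.
move=> h; apply: lb_le_inf; first by exists (rho z (g y0)); exists y0.
by move=> _ [y _ <-].
Qed.

Lemma dist_to_gt0 z : ~ range g z -> 0 < dist_to z.
Proof. by move=> /g_closed[r r0 h]; rewrite (lt_le_trans r0)// le_dist_to. Qed.

Lemma dist_to_range y : dist_to (g y) = 0.
Proof.
apply/eqP; rewrite eq_le -{1}(dist_refl rhoM (g y)) dist_to_le/=.
by apply: le_dist_to => y'; exact: dist_ge0.
Qed.

Lemma dist_to_lipschitz z z' : dist_to z <= rho z z' + dist_to z'.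
Proof.
rewrite -lerBlDl; apply: le_dist_to => y.
have := dist_to_le z y; have := dist_triangular rhoM z z' (g y); lra.
Qed.

(** Such a [y] has penalty 0 at [z]; this is what the 2 in [penalty] is for. *)
Lemma exists_near z : ~ range g z -> exists y, rho z (g y) < 2 * dist_to z.
Proof.
move=> zg; apply: contrapT => h.
have d0 := dist_to_gt0 zg.
have : 2 * dist_to z <= dist_to z.
  by apply: le_dist_to => y; rewrite leNgt; apply/negP => ?; apply: h; exists y.
lra.
Qed.

Lemma penalty_ge0 z y : 0 <= penalty z y.
Proof. by rewrite le_max lexx. Qed.

Lemma hausdorff_extension_range v y : hausdorff_extension v (g y) = v y.
Proof.
rewrite /hausdorff_extension (_ : [set _ | _ in _] = [set v y]) ?inf1//.
have p0 : penalty (g y) y = 0.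
  rewrite /penalty dist_to_range invr0 mulr0 sub0r; apply/max_idPl; lra.
apply/seteqP; split => [_ /= [y' h <-]|_ ->].
  have -> : y' = y by apply: g_inj; apply: h; exists y.
  by rewrite p0 addr0.
by exists y; rewrite ?p0 ?addr0.
Qed.

Lemma hausdorff_extension_le v z y : (forall y, 0 <= v y) -> ~ range g z ->
  hausdorff_extension v z <= v y + penalty z y.
Proof.
move=> v0 zg; apply: ge_inf; last by exists y.
by exists 0 => _ [y' _ <-]; rewrite addr_ge0 ?penalty_ge0.
Qed.

Lemma le_hausdorff_extension v z c : ~ range g z ->
  (forall y, c <= v y + penalty z y) -> c <= hausdorff_extension v z.
Proof.
move=> zg h; apply: lb_le_inf; last by move=> _ [y _ <-].
by exists (v y0 + penalty z y0); exists y0.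
Qed.

Lemma hausdorff_extension_ge0 v z : (forall y, 0 <= v y) ->
  0 <= hausdorff_extension v z.
Proof.
move=> v0; have [[y _ <-]|zg] := pselect (range g z).
  by rewrite hausdorff_extension_range.
by apply: le_hausdorff_extension => // y; rewrite addr_ge0 ?penalty_ge0.
Qed.

Lemma hausdorff_extension_bounded {I} (v : I -> Y -> R) z :
  (forall i y, 0 <= v i y) -> (forall y, exists C, forall i, v i y <= C) ->
  exists C, forall i, hausdorff_extension (v i) z <= C.
Proof.
move=> v0 vb; have [[y _ <-]|zg] := pselect (range g z).
  by have [C hC] := vb y; exists C => i; rewrite hausdorff_extension_range.
have [C hC] := vb y0; exists (C + penalty z y0) => i.
by rewrite (le_trans (hausdorff_extension_le y0 (v0 i) zg)) ?lerD2r.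
Qed.

(** In the infimum, a [y] whose ratio [rho z (g y) / dist_to z] exceeds [K + 2] is too heavily
    penalized to matter. The remaining ones lie near [b] when [z'] is near [g b], and their ratios
    vary little around a point off the range. *)
Lemma hausdorff_extension_equicontinuous {I} (v : I -> Y -> R) :
  (forall i y, 0 <= v i y) -> (forall y, exists C, forall i, v i y <= C) ->
  equicontinuous_wrt (fun y y' => rho (g y) (g y')) v ->
  equicontinuous_wrt rho (fun i => hausdorff_extension (v i)).
Proof.
move=> v0 vb vc z e e0; have [[b _ <-]|zg] := pselect (range g z).
  have [C hC] := vb b; have [eta eta0 heta] := vc b e e0.
  pose K := Num.max 0 C; have K0 : 0 <= K by rewrite le_max lexx.
  have CK : C <= K by rewrite le_max lexx orbT.
  (* If [rho z' (g y)] is at most [(K + 2) * dist_to z'], then [rho (g b) (g y)] is at most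
     [(K + 3) * rho (g b) z']. *)
  exists (eta / (K + 3)); first by rewrite divr_gt0//; lra.
  move=> z' hz' i; rewrite hausdorff_extension_range.
  have {}hz' : (K + 3) * rho (g b) z' < eta.
    by rewrite mulrC -ltr_pdivlMr//; lra.
  have r0 := dist_ge0 rhoM (g b) z'.
  have [[y _ gy]|zg] := pselect (range g z').
    rewrite -gy hausdorff_extension_range; apply: heta; rewrite gy; nra.
  have d0 := dist_to_gt0 zg.
  have db : dist_to z' <= rho (g b) z'.
    by rewrite (dist_symmetric rhoM); exact: dist_to_le.
  rewrite ler_norml; apply/andP; split.
    have [y hy] := exists_near zg.
    have p0 : penalty z' y = 0.
      by apply/max_idPl; rewrite subr_le0 ler_pdivrMr// ltW.
    have := hausdorff_extension_le y (v0 i) zg; rewrite p0.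
    have tri := dist_triangular rhoM (g b) z' (g y).
    have /heta/(_ i) : rho (g b) (g y) < eta by nra.
    by rewrite ler_norml => /andP[]; lra.
  rewrite lerBlDr -lerBlDl; apply: le_hausdorff_extension => // y.
  have p0 := penalty_ge0 z' y.
  have tri := dist_triangular rhoM (g b) z' (g y).
  have [hy|hy] := leP (rho z' (g y)) ((K + 2) * dist_to z').
    have /heta/(_ i) : rho (g b) (g y) < eta by nra.
    by rewrite ler_norml => /andP[]; lra.
  have : K <= penalty z' y.
    rewrite le_max; apply/orP; right.
    by rewrite lerBrDr ler_pdivlMr// ltW.
  have := hC i; have := v0 i y; lra.
have d0 := dist_to_gt0 zg.
have [y1 hy1] := exists_near zg.
have [C hC] := vb y1.
(* The 5 bounds the penalty of [y1] at points within [dist_to z / 2] of [z]. *)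
pose K := Num.max 0 C + 5.
have K5 : 5 <= K by rewrite lerDr le_max lexx.
have CK : C + 5 <= K by rewrite lerD2r le_max lexx orbT.
(* Within [s] of [z], [dist_to] is at least [dist_to z / 2]. A ratio [q] of at most [K + 2] then
   grows by at most [2 * s * (1 + q) / (dist_to z / 2)], hence by at most [e]. *)
pose s := Num.min (dist_to z / 2) (e * dist_to z / (4 * (K + 3))).
have sd : s <= dist_to z / 2 by rewrite ge_min lexx.
have se : 4 * (K + 3) * s <= e * dist_to z.
  by rewrite mulrC -ler_pdivlMr ?ge_min ?lexx ?orbT//; lra.
have s0 : 0 < s.
  by rewrite lt_min !divr_gt0//= ?mulr_gt0//; lra.
have key z1 z2 i : rho z z1 < s -> rho z z2 < s ->
    hausdorff_extension (v i) z2 <= hausdorff_extension (v i) z1 + e.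
  move=> h1 h2.
  have dz1 := dist_to_lipschitz z z1.
  have dz2 := dist_to_lipschitz z z2.
  have dz2' := dist_to_lipschitz z1 z2.
  have r12 : rho z1 z2 < 2 * s.
    have := dist_triangular rhoM z1 z z2.
    by rewrite (dist_symmetric rhoM z1 z); lra.
  have r21 : rho z2 z1 < 2 * s by rewrite (dist_symmetric rhoM).
  have ng x : 0 < dist_to x -> ~ range g x.
    by move=> + [y _ gy]; rewrite -gy dist_to_range ltxx.
  have p1 : 0 < dist_to z1 by lra.
  have p2 : dist_to z / 2 <= dist_to z2 by lra.
  have p2' : 0 < dist_to z2 by lra.
  rewrite -lerBlDr; apply: (le_hausdorff_extension (ng _ p1)) => y.
  rewrite lerBlDr.
  (* A [y] far from [z1] is outdone by [y1]; otherwise the same [y] is used at [z1] and [z2]. *)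
  have [hy|hy] := leP (rho z1 (g y)) ((K + 2) * dist_to z1); last first.
    apply: (le_trans (hausdorff_extension_le y1 (v0 i) (ng _ p2'))).
    have : penalty z2 y1 <= 5.
      rewrite ge_max; apply/andP; split; first by [].
      rewrite lerBlDr ler_pdivrMr//.
      have := dist_triangular rhoM z2 z (g y1).
      by rewrite (dist_symmetric rhoM z2 z); lra.
    have : K <= penalty z1 y.
      rewrite le_max; apply/orP; right.
      by rewrite lerBrDr ler_pdivlMr// ltW.
    have := hC i; have := v0 i y; lra.
  apply: (le_trans (hausdorff_extension_le y (v0 i) (ng _ p2'))).
  rewrite -addrA lerD2l.
  rewrite {1}/penalty ge_max; apply/andP; split.
    by rewrite addr_ge0 ?penalty_ge0// ltW.
  have : rho z1 (g y) / dist_to z1 - 2 <= penalty z1 y.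
    by rewrite le_max lexx orbT.
  suff : rho z2 (g y) / dist_to z2 <= rho z1 (g y) / dist_to z1 + e by lra.
  set q := rho z1 (g y) / dist_to z1.
  have q0 : 0 <= q by rewrite divr_ge0 ?(dist_ge0 rhoM)// ltW.
  have qK : q <= K + 2 by rewrite ler_pdivrMr.
  have qE : rho z1 (g y) = q * dist_to z1 by rewrite divfK// gt_eqF.
  rewrite ler_pdivrMr//.
  have := dist_triangular rhoM z2 z1 (g y); rewrite qE.
  have : q * dist_to z1 <= q * (dist_to z2 + 2 * s).
    by rewrite ler_wpM2l//; lra.
  have : q * s <= (K + 2) * s by rewrite ler_wpM2r// ltW.
  have : e * (dist_to z / 2) <= e * dist_to z2 by rewrite ler_wpM2l// ltW.
  rewrite mulrDl; lra.
exists s => // z' hz' i.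
have hz : rho z z < s by rewrite (dist_refl rhoM).
have := key z z' i hz hz'; have := key z' z i hz' hz.
by rewrite ler_norml; lra.
Qed.

End HausdorffExtension.

(** * Truncated metrics and metrics enlarged by a family of functions *)

Section Metrics.
Context {R : realType}.

Lemma Met_equivalent (Z : topologicalType) (d e : Z -> Z -> R) :
  Met R Z d -> is_metric e ->
  (forall z r, 0 < r ->
    exists2 s, 0 < s & forall z', d z z' < s -> e z z' < r) ->
  (forall z r, 0 < r ->
    exists2 s, 0 < s & forall z', e z z' < s -> d z z' < r) ->
  Met R Z e.
Proof.
move=> [dM dT] eM de ed; split=> // U; rewrite dT.
split=> h x /h[r r0 rU].
  by have [s s0 hs] := ed x r r0; exists s => // y /hs; exact: rU.
by have [s s0 hs] := de x r r0; exists s => // y /hs; exact: rU.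
Qed.

Definition truncation {T : Type} (d : T -> T -> R) c x y := Num.min (d x y) c.

Lemma is_metric_truncation {T : Type} (d : T -> T -> R) c :
  0 < c -> is_metric d -> is_metric (truncation d c).
Proof.
move=> c0 dM; rewrite /truncation; split.
- by move=> x; rewrite (dist_refl dM); apply/min_idPl/ltW.
- move=> x y; case: leP => [_|_ c0']; first exact: (dist_separated dM).
  by rewrite c0' ltxx in c0.
- by move=> x y; rewrite (dist_symmetric dM).
- move=> x y z; have := dist_triangular dM x y z.
  have := dist_ge0 dM x y; have := dist_ge0 dM y z.
  by case: (leP (d x y) c); case: (leP (d y z) c); case: (leP (d x z) c); lra.
Qed.

Lemma Met_truncation (Z : topologicalType) (d : Z -> Z -> R) c :
  0 < c -> Met R Z d -> Met R Z (truncation d c).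
Proof.
move=> c0 dM; apply: (Met_equivalent dM).
- by case: dM => + _; exact: is_metric_truncation.
- by move=> z r r0; exists r => // z' h; rewrite gt_min h.
(* A truncated value below [c] is the original one. *)
- move=> z r r0; exists (Num.min r c); first by rewrite lt_min r0.
  by move=> z'; rewrite gt_min !lt_min ltxx andbF orbF => /andP[].
Qed.

Lemma truncation_nonexpansive {T : Type} (d e : T -> T -> R) c r x y :
  `|d x y - e x y| <= r -> `|truncation d c x y - truncation e c x y| <= r.
Proof.
rewrite /truncation !ler_norml.
by case: (leP (d x y) c); case: (leP (e x y) c); lra.
Qed.

Section SupDist.
Context {I Z : Type} (i0 : I).
Implicit Types h : I -> Z -> R.

Definition pointwise_bounded h := forall z, exists C, forall i, `|h i z| <= C.

(** The uniform distance pulled back along [z |-> (h i z)_i]; pointwise boundedness makes the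
    supremum a genuine one. *)
Definition sup_dist h z z' := sup (range (fun i => `|h i z - h i z'|)).

Lemma le_sup_dist h z z' i : pointwise_bounded h ->
  `|h i z - h i z'| <= sup_dist h z z'.
Proof.
move=> hb; apply: ub_le_sup; last by exists i.
have [C hC] := hb z; have [C' hC'] := hb z'.
exists (C + C') => _ [j _ <-]; apply: le_trans (ler_normB _ _) _.
by apply: lerD.
Qed.

Lemma sup_dist_le h z z' c : (forall i, `|h i z - h i z'| <= c) ->
  sup_dist h z z' <= c.
Proof.
move=> hc; apply: ge_sup; last by move=> _ [i _ <-].
by exists `|h i0 z - h i0 z'|; exists i0.
Qed.

Lemma sup_dist_nonexpansive h h' z z' c :
  pointwise_bounded h -> pointwise_bounded h' ->
  (forall i, `| `|h i z - h i z'| - `|h' i z - h' i z'| | <= c) ->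
  `|sup_dist h z z' - sup_dist h' z z'| <= c.
Proof.
move=> hb hb' hc; rewrite ler_norml; apply/andP; split.
  rewrite lerNl opprB lerBlDr.
  apply: sup_dist_le => i; have := le_sup_dist z z' i hb.
  by have := hc i; rewrite (ler_norml (_ - _)) => /andP[]; lra.
rewrite lerBlDr; apply: sup_dist_le => i; have := le_sup_dist z z' i hb'.
by have := hc i; rewrite (ler_norml (_ - _)) => /andP[]; lra.
Qed.

Definition adjoin (d : Z -> Z -> R) h z z' :=
  Num.max (d z z') (sup_dist h z z').

Lemma is_metric_adjoin d h :
  is_metric d -> pointwise_bounded h -> is_metric (adjoin d h).
Proof.
move=> dM hb; rewrite /adjoin; split.
- move=> z; rewrite (dist_refl dM); apply/max_idPl.
  by apply: (@sup_dist_le h) => i; rewrite subrr normr0.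
- move=> z z' h0; apply: (dist_separated dM); apply/eqP.
  by rewrite eq_le (dist_ge0 dM) andbT -h0 le_max lexx.
- move=> z z'; rewrite (dist_symmetric dM); congr Num.max.
  by rewrite /sup_dist; under eq_fun do rewrite distrC.
- move=> x y z; rewrite ge_max; apply/andP; split.
    by apply: le_trans (dist_triangular dM x y z) _; rewrite lerD// le_max lexx.
  apply: sup_dist_le => i; apply: le_trans (ler_distD (h i y) _ _) _.
  by rewrite lerD// le_max le_sup_dist// orbT.
Qed.

End SupDist.

(** The maximum with [d] keeps the topology from becoming coarser, equicontinuity from becoming
    finer. *)
Lemma Met_adjoin {I} (i0 : I) (Z : topologicalType) (d : Z -> Z -> R)
    (h : I -> Z -> R) :
  Met R Z d -> pointwise_bounded h -> equicontinuous_wrt d h ->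
  Met R Z (adjoin d h).
Proof.
move=> dM hb hc; apply: (Met_equivalent dM).
- by case: dM => dM _; exact: is_metric_adjoin.
- move=> z r r0; have [|s s0 hs] := hc z (r / 2); first by rewrite divr_gt0.
  exists (Num.min s r); first by rewrite lt_min s0.
  move=> z'; rewrite lt_min => /andP[/hs h1 h2]; rewrite gt_max h2/=.
  by apply: le_lt_trans (sup_dist_le i0 h1) _; lra.
- by move=> z r r0; exists r => // z'; rewrite gt_max => /andP[].
Qed.

Lemma adjoin_nonexpansive {I Z} (i0 : I) (d : Z -> Z -> R)
    (h h' : I -> Z -> R) z z' c :
  pointwise_bounded h -> pointwise_bounded h' ->
  (forall i, `| `|h i z - h i z'| - `|h' i z - h' i z'| | <= c) ->
  `|adjoin d h z z' - adjoin d h' z z'| <= c.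
Proof.
move=> hb hb' /(sup_dist_nonexpansive i0 hb hb').
rewrite /adjoin !ler_norml.
by case: (leP _ (sup_dist h z z')); case: (leP _ (sup_dist h' z z')); lra.
Qed.

End Metrics.

(** * The family of metrics on [Z] indexed by [X] *)

Section Construction.
Context {R : realType} {Z : topologicalType} {X Y : metricType R}.
Context (rho : Z -> Z -> R) (i : X -> Y) (g : Y -> Z) (p : Z) (x0 : X).
Context (rhoM : Met R Z rho) (i_iso : isometric_embedding i).
Context (g_inj : injective g).
Context (g_closed :
  forall z, ~ range g z -> exists2 r, 0 < r & forall y, r <= rho z (g y)).
Context (g_open : forall y e, 0 < e -> exists2 s, 0 < s &
  forall y', rho (g y) (g y') < s -> mdist y y' < e).
Context (gp : ~ range g p).

Let D := @mdist R Y.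

(* The last summand makes these functions nonnegative. *)
Let v a y := D y (i a) - D (i x0) (i a) + D y (i x0).

Let v_ge0 a y : 0 <= v a y.
Proof.
have := metric_triangle (i x0) y (i a); rewrite (metric_sym (i x0) y) /v /D.
lra.
Qed.

Let v_bounded y : exists C, forall a, v a y <= C.
Proof.
exists (2 * D y (i x0)) => a.
by have := metric_triangle y (i x0) (i a); rewrite /v /D; lra.
Qed.

(** Every [v a] is 2-Lipschitz for [D], and [g_open] turns closeness in [rho] into closeness in
    [D]. *)
Let v_equicontinuous : equicontinuous_wrt (fun y y' => rho (g y) (g y')) v.
Proof.
move=> y e e0; have [|s s0 hs] := g_open y (e := e / 2).
  by rewrite divr_gt0.
exists s => // y' /hs yy' a; rewrite /v /D ler_norml.
have := metric_triangle y y' (i a); have := metric_triangle y' y (i a).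
have := metric_triangle y y' (i x0); have := metric_triangle y' y (i x0).
rewrite (metric_sym y' y); lra.
Qed.

Let V a := hausdorff_extension rho g (v a).

(* [v x0] is [2 * D _ (i x0)], so this removes the last summand of [v a]. *)
Let h a z := V a z - V x0 z / 2.

Let h_range a y : h a (g y) = D y (i a) - D (i x0) (i a).
Proof.
case: rhoM => rhom _.
rewrite /h /V !(hausdorff_extension_range rhom g_inj (i x0)) /v /D mdistxx; lra.
Qed.

Let h_bounded : pointwise_bounded h.
Proof.
case: rhoM => rhom _ z.
have [C hC] :=
  hausdorff_extension_bounded rhom g_inj (i x0) z v_ge0 v_bounded.
exists (2 * C) => a; rewrite /h /V ler_norml.
have := hausdorff_extension_ge0 rhom g_inj (i x0) z (v_ge0 a).
have := hausdorff_extension_ge0 rhom g_inj (i x0) z (v_ge0 x0).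
have := hC a; have := hC x0; lra.
Qed.

Let h_equicontinuous : equicontinuous_wrt rho h.
Proof.
case: rhoM => rhom _ z e e0.
have [|s s0 hs] := hausdorff_extension_equicontinuous rhom g_inj g_closed
  (i x0) v_ge0 v_bounded v_equicontinuous z (e := e / 2).
  by rewrite divr_gt0.
exists s => // z' /hs {}hs a; have := hs a; have := hs x0.
by rewrite /h /V !ler_norml; lra.
Qed.

(** The last two clauses bound the sup-metric from below at the pair [(g (i x'), p)], in a form that
    survives truncation. *)
Lemma exists_isometric_Met : exists J : X -> Z -> Z -> R,
  [/\ forall x, Met R Z (J x),
      forall x x' z z', `|J x z z' - J x' z z'| <= mdist x x',
      forall x, J x (g (i x)) p = 1 &
      forall x x', mdist x x' + 1 <= J x (g (i x')) p].
Proof.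
have rhom : is_metric rho by case: rhoM.
have [r r0 hr] := g_closed gp.
pose phi z := Num.max 0 (1 - rho p z / r).
have phi_ge0 z : 0 <= phi z by rewrite le_max lexx.
have phi_le1 z : phi z <= 1.
  by rewrite ge_max ler01/= lerBlDr lerDl divr_ge0// ?dist_ge0// ltW.
have phip : phi p = 1.
  by rewrite /phi (dist_refl rhom) mul0r subr0; apply/max_idPr.
have phig y : phi (g y) = 0.
  by apply/max_idPl; rewrite subr_le0 ler_pdivlMr// mul1r.
have phi_lip z z' : `|phi z - phi z'| <= rho z z' / r.
  have : rho p z / r <= rho p z' / r + rho z z' / r.
    rewrite -mulrDl ler_wpM2r ?invr_ge0 ?(ltW r0)//.
    by rewrite (dist_symmetric rhom z z') (dist_triangular rhom).
  have : rho p z' / r <= rho p z / r + rho z z' / r.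
    by rewrite -mulrDl ler_wpM2r ?invr_ge0 ?(ltW r0)// (dist_triangular rhom).
  have : 0 <= rho z z' / r by rewrite divr_ge0 ?dist_ge0// ltW.
  rewrite /phi ler_norml.
  by case: (leP 0 (1 - rho p z / r)); case: (leP 0 (1 - rho p z' / r)); lra.
(* The Kuratowski coordinates of [i x], each raised by 1, which puts [p] at distance 1 from
   [g (i x)]. *)
pose c x a := mdist x a - mdist x0 a + 1.
have c_le x a : `|c x a| <= mdist x x0 + 1.
  rewrite /c ler_norml; have := metric_triangle x x0 a.
  have := metric_triangle x0 x a; rewrite (metric_sym x0 x); lra.
(* [H x] maps [g y] to [D y (i a) - mdist x0 a] and [p] to [c x a], hence only
   the values off the range of [g] depend on [x]. *)
pose H x a z := h a z + phi z * (c x a - h a z).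
have Hg x a y : H x a (g y) = D y (i a) - mdist x0 a.
  by rewrite /H phig mul0r addr0 h_range /D i_iso.
have Hp x a : H x a p = c x a by rewrite /H phip; ring.
have Hb x : pointwise_bounded (H x).
  move=> z; have [C hC] := h_bounded z.
  exists (C + (mdist x x0 + 1 + C)) => a; rewrite /H.
  apply: le_trans (ler_normD _ _) _; rewrite lerD//.
  rewrite normrM -[leRHS]mul1r ler_pM//; first by rewrite ger0_norm.
  by rewrite (le_trans (ler_normB _ _))// lerD.
have Hc x : equicontinuous_wrt rho (H x).
  move=> z e e0; have [C hC] := h_bounded z.
  pose K := mdist x x0 + 1 + C.
  have K0 : 0 < K + 1.
    have := normr_ge0 (h x0 z); have := hC x0.
    by have := mdist_ge0 x x0; rewrite /K; lra.
  have [|s s0 hs] := h_equicontinuous z (e := e / 2); first by rewrite divr_gt0.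
  exists (Num.min s (e / 2 / (K + 1) * r)).
    by rewrite lt_min s0 mulr_gt0// !divr_gt0.
  move=> z'; rewrite lt_min => /andP[/hs hh].
  rewrite -ltr_pdivrMr// => rz a.
  (* This splitting needs a bound on [h a] only at the fixed point [z]; the second term is small
     because [phi] is Lipschitz with constant [1 / r]. *)
  have -> : H x a z - H x a z' =
      (1 - phi z') * (h a z - h a z') + (phi z - phi z') * (c x a - h a z).
    by rewrite /H; ring.
  apply: le_trans (ler_normD _ _) _; rewrite !normrM.
  have : `|1 - phi z'| * `|h a z - h a z'| <= e / 2.
    rewrite -[leRHS]mul1r ler_pM//.
    by rewrite ler_norml; have := phi_ge0 z'; have := phi_le1 z'; lra.
  have : `|phi z - phi z'| * `|c x a - h a z| <= e / 2.
    have cK : `|c x a - h a z| <= K + 1.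
      apply: le_trans (ler_normB _ _) _.
      by have := hC a; have := c_le x a; rewrite /K; lra.
    apply: (@le_trans _ _ (e / 2 / (K + 1) * (K + 1))).
      by rewrite ler_pM// (le_trans (phi_lip _ _))// ltW.
    by rewrite divfK// gt_eqF.
  lra.
(* Truncation at 1 prevents [rho] from exceeding the value 1 required at [(g (i x), p)]. *)
exists (fun x => adjoin (truncation rho 1) (H x)); split.
- move=> x; apply: (Met_adjoin x0) => //; first exact: Met_truncation.
  move=> z e e0; have [s s0 hs] := Hc x z e e0.
  exists (Num.min s 1); first by rewrite lt_min s0 ltr01.
  move=> z'; rewrite /truncation gt_min !lt_min ltxx andbF orbF.
  by move=> /andP[/hs].
- move=> x x' z z'; apply: (adjoin_nonexpansive x0) => // a.
  apply: le_trans (ler_dist_dist _ _) _.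
  have -> : H x a z - H x a z' - (H x' a z - H x' a z') =
      (phi z - phi z') * (mdist x a - mdist x' a).
    by rewrite /H /c; ring.
  rewrite normrM -[leRHS]mul1r ler_pM//.
    have := phi_ge0 z; have := phi_le1 z.
    by have := phi_ge0 z'; have := phi_le1 z'; rewrite ler_norml; lra.
  have := metric_triangle x x' a; have := metric_triangle x' x a.
  by rewrite (metric_sym x' x) ler_norml; lra.
- move=> x; have E a : `|H x a (g (i x)) - H x a p| = 1.
    rewrite Hg Hp /c /D i_iso.
    rewrite (_ : _ - _ = -1) ?normrN1//; ring.
  apply/eqP; rewrite eq_le; apply/andP; split.
    rewrite ge_max /truncation ge_min lexx orbT/=.
    by apply: (sup_dist_le x0) => a; rewrite E.
  by rewrite le_max -(E x0) (le_sup_dist _ _ _ (Hb x)) orbT.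
- move=> x x'; rewrite le_max; apply/orP; right.
  (* The coordinate [a = x'] suffices: there [D (i x') (i a)] vanishes and the difference is
     [mdist x x' + 1]. *)
  apply: le_trans _ (le_sup_dist _ _ x' (Hb x)).
  rewrite Hg Hp /c /D i_iso mdistxx -normrN.
  by apply: le_trans (ler_norm _); lra.
Qed.

End Construction.

(** * The sup-metric, the topological sum and the conclusion *)

Lemma sup_metric_attained {R : realType} {Z : Type} (d e : Z -> Z -> R) c z z' :
  (forall x y, `|d x y - e x y| <= c) -> c <= `|d z z' - e z z'| ->
  sup_metric d e = c%:E.
Proof.
move=> dc cd; apply/eqP; rewrite eq_le; apply/andP; split.
  by apply: ge_ereal_sup => _ [[x y] _ <-]; rewrite lee_fin dc.
apply: le_ereal_sup_tmp; exists `|d z z' - e z z'|%:E; last by rewrite lee_fin.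
by exists (z, z').
Qed.

(** Restates the embedding through [rho]. The range of [g] is closed because each summand is open in
    the sum and the range of [f] is closed. *)
Lemma topological_sum_embedding {R : realType} (Z : topologicalType)
    (Y : metricType R) (rho : Z -> Z -> R)
    (f : topological_sum Y one_point -> Z) :
  Met R Z rho -> closed_topological_embedding f ->
  exists (g : Y -> Z) p, [/\ injective g,
      forall z, ~ range g z -> exists2 r, 0 < r & forall y, r <= rho z (g y),
      forall y e, 0 < e -> exists2 s, 0 < s &
        forall y', rho (g y) (g y') < s -> mdist y y' < e &
      ~ range g p].
Proof.
move=> [_ rhoT] [f_inj _ f_closed f_open].
pose g y := f (existT (summand Y one_point) false y).
have g_inj : injective g.
  by move=> y y' /f_inj; apply: (existT_inj2 (P := summand Y one_point)).
pose p := f (existT (summand Y one_point) true tt).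
have gp : ~ range g p by move=> [y _ /f_inj].
have ball_open (U : set Z) z : open U -> U z ->
    exists2 r, 0 < r & forall z', rho z z' < r -> U z'.
  by move=> /rhoT h /h.
(* Continuity of the inverse of [f], in terms of [rho]-balls. *)
have f_inv (U : set (topological_sum Y one_point)) s : open U -> U s ->
    exists2 r, 0 < r & forall s', rho (f s) (f s') < r -> U s'.
  move=> /f_open/open_subspaceP[O oO OE] Us.
  have fU s' : (O `&` range f) (f s') -> U s'.
    by rewrite OE => -[[s1 Us1 /f_inj <-] _].
  have [|r r0 hr] := ball_open _ (f s) oO.
    have : ((f @` U) `&` range f) (f s) by split; exists s.
    by rewrite -OE => -[].
  by exists r => // s' /hr Os'; apply: fU; split=> //; exists s'.
exists g, p; split=> //.
- move=> z zg; have [[[[] u] _ fz]|zf] := pselect (range f z).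
  + have oU := @existT_open_map _ (summand Y one_point) true _ openT.
    have [|r r0 hr] := f_inv _ (existT _ true u) oU; first by exists u.
    exists r => // y; rewrite leNgt; apply/negP; rewrite -fz => /hr.
    by move=> [].
  + by case: zg; exists u.
  + have [r r0 hr] := ball_open _ z (closed_openC f_closed) zf.
    exists r => // y; rewrite leNgt; apply/negP => /hr; apply.
    by exists (existT _ false y).
- move=> y e e0.
  have oU := @existT_open_map _ (summand Y one_point) false _
    (open_interior (ball y e)).
  have [|r r0 hr] := f_inv _ (existT _ false y) oU.
    by exists y => //; exact: nbhsx_ballx.
  exists r => // y' /hr [y1 /interior_subset y1e].
  move=> /(existT_inj2 (P := summand Y one_point)) <-.
  by move: y1e; rewrite ballEmdist.
Qed.

Theorem theorem1p1 (R : realType) (Z : topologicalType) (X : metricType R)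
  (hZ : metrizable R Z)
  (hX : exists Y : metricType R,
      (exists i : X -> Y, isometric_embedding i) /\
      (exists f : topological_sum Y one_point -> Z,
         closed_topological_embedding f)) :
  (exists J : X -> Z -> Z -> R, isometric_embedding_in (Met R Z) J) /\
  (bounded_dist (@mdist R X) ->
   exists J : X -> Z -> Z -> R, isometric_embedding_in (BMet R Z) J).
Proof.
have [[x0 _]|X0] := pselect (exists x : X, True); last first.
  by split=> [|_]; exists (fun _ _ _ => 0); split=> x; case: X0; exists x.
case: hZ hX => rho rhoM [Y [[i i_iso] [f fE]]].
have [g [p [g_inj g_closed g_open gp]]] := topological_sum_embedding rhoM fE.
have [J [JM Jle J1 Jge]] :=
  exists_isometric_Met x0 rhoM i_iso g_inj g_closed g_open gp.
split.
  exists J; split=> [//|x y].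
  apply: (sup_metric_attained (z := g (i y)) (z' := p)); first exact: Jle.
  by rewrite J1 (le_trans _ (ler_norm _))// lerBrDr.
move=> [M hM]; have M0 : 0 <= M by rewrite -(mdistxx x0).
have M1 : 0 < M + 1 by lra.
exists (fun x => truncation (J x) (M + 1)); split=> [x|x y].
  split; first exact: Met_truncation.
  by exists (M + 1) => z z'; rewrite ge_min lexx orbT.
apply: (sup_metric_attained (z := g (i y)) (z' := p)).
  by move=> z z'; apply: truncation_nonexpansive.
(* Truncation at [M + 1] fixes the value 1 as [0 <= M], and keeps the bound [mdist x y + 1] as
   [mdist x y <= M]. *)
rewrite /truncation J1 (le_trans _ (ler_norm _))// lerBrDr.
rewrite (min_idPl _) ?lerDr//.
by rewrite le_min Jge lerD2r hM.
Qed.
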